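(* Let $F$ be a finite forest. Then $[Z_F]\in\mathbf{Z}[q]$; that is, there is a polynomial $f\in\mathbf{Z}[q]$ with $\#Z_F(\mathbf{F}_q)=f(q)$ for all prime powers $q$.
   Context: A forest is a simple graph (no loops, no multiple edges) with no cycles. For a finite simple graph $G$ with vertices $v_1,\dots,v_n$, $Z_G$ is the scheme over $\mathbf{Z}$ of all nondegenerate (invertible) symmetric $n\times n$ matrices $M$ such that $M_{ij}=0$ whenever there is an edge from $v_i$ to $v_j$. $[Z_G]$ is the function $q\mapsto \#Z_G(\mathbf{F}_q)$ on prime powers $q$. *)

(* Defs.v *)
From mathcomp Require Import all_boot all_order all_algebra.

Set Implicit Arguments.
Unset Strict Implicit.
Unset Printing Implicit Defensive.

Import GRing.Theory.
Local Open Scope ring_scope.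

Definition simple_graph (T : finType) (e : rel T) : Prop :=
  symmetric e /\ irreflexive e.

(* In a simple graph a cycle has at least three vertices; the size condition
   also discards the sequences [::] and [:: x; y] with e x y, which [ucycle]
   accepts. *)
Definition graph_cycle (T : finType) (e : rel T) (c : seq T) : Prop :=
  (2 < size c)%N /\ ucycle e c.

Definition forest (T : finType) (e : rel T) : Prop :=
  simple_graph e /\ (forall c : seq T, ~ graph_cycle e c).

(* The R-points of the scheme Z_G, for the graph G on 'I_n with edge relation
   e. The diagonal entries are not constrained by the graph. *)
Definition Z_points (n : nat) (e : rel 'I_n) (R : comUnitRingType) :
    pred 'M[R]_n :=
  fun M => [&& M \in unitmx, M^T == M &
               [forall i, forall j, e i j ==> (M i j == 0)]].

(* The value of [Z_G] at q = #|K|. *)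
Definition Z_count (n : nat) (e : rel 'I_n) (K : finFieldType) : nat :=
  #|[set M : 'M[K]_n | Z_points e M]|.

(* Main.v *)
Require Import Defs.
From mathcomp Require Import all_boot all_order all_algebra all_fingroup.

(* Let [v] be a vertex without edges (nor a loop), [w != v], and [q = #|K|]. Among the
   matrices of [Z_e], those whose row [w] vanishes off column [v] are invertible
   exactly when [M v w != 0] and the matrix with [v] and [w] deleted is, so there
   are [(q - 1) q^(n-1) Z_(e-v-w)] of them, [n] being the number of vertices. On
   all the others [M v w] is equidistributed: if [M w k != 0] with [k != v], adding
   a multiple of row and column [k] to row and column [v] shifts [M v w] and
   respects the constraints. Hence
     [Z_e = q Z_(e+vw) + (q - 1) q^(n-1) Z_(e-v-w)].
   Applied to a leaf [v] of a forest with neighbour [w], this computes [q Z] from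
   smaller forests, and division by [q] is harmless. The edgeless graph is treated
   by a Schur complement when [M 0 0 != 0]; when [M 0 0 = 0], there is a loop at
   [0], to which the same recursion adds edges until row [0] vanishes. *)

Set Implicit Arguments.
Unset Strict Implicit.
Unset Printing Implicit Defensive.

Import GRing.Theory.
Local Open Scope ring_scope.

(** * Membership in [Z_points] and relabelling of vertices *)

Definition add_edge (T : finType) (v w : T) (e : rel T) : rel T :=
  fun i j => [|| e i j, (i == v) && (j == w) | (i == w) && (j == v)].

Lemma Z_pointsP (n : nat) (e : rel 'I_n) (R : comUnitRingType) (M : 'M[R]_n) :
  reflect [/\ M \in unitmx, forall i j, M i j = M j i
            & forall i j, e i j -> M i j = 0] (Z_points e M).
Proof.
apply: (iffP and3P) => -[uM sM zM]; split=> //.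
- by move=> i j; rewrite -{1}(eqP sM) mxE.
- by move=> i j eij; move/forallP/(_ i)/forallP/(_ j): zM; rewrite eij => /eqP.
- by apply/eqP/matrixP => i j; rewrite mxE sM.
- by apply/forallP => i; apply/forallP => j; apply/implyP => /zM/eqP.
Qed.

Lemma eq_Z_count (n : nat) (e e' : rel 'I_n) (K : finFieldType) :
  e =2 e' -> Z_count e K = Z_count e' K.
Proof.
move=> ee'; apply: eq_card => M; rewrite !inE.
by apply/Z_pointsP/Z_pointsP => -[uM sM zM]; split=> // i j h; apply: zM;
  rewrite ?ee' // -ee'.
Qed.

(** Permuting rows and columns simultaneously is a bijection between the two sets of matrices. This
    later moves [v] and [w] to the first two indices. *)
Lemma Z_count_relpre_perm (n : nat) (e : rel 'I_n) (s : 'S_n)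
    (K : finFieldType) : Z_count (relpre s e) K = Z_count e K.
Proof.
pose g (t : 'S_n) (M : 'M[K]_n) := row_perm t (col_perm t M).
have gE t M i j : g t M i j = M (t i) (t j) by rewrite !mxE.
have gI t : injective (g t).
  move=> M N /matrixP MN; apply/matrixP => i j.
  by have := MN (t^-1 i)%g (t^-1 j)%g; rewrite !gE !permKV.
have g_unit t M : (g t M \in unitmx) = (M \in unitmx).
  by rewrite /g row_permE col_permE !unitmx_mul !unitmx_perm andbT.
rewrite /Z_count -(on_card_preimset (onW_bij _ (injF_bij (gI s)))).
apply/esym/eq_card => M; rewrite !inE.
apply/Z_pointsP/Z_pointsP => -[uM sM zM]; split.
- by rewrite g_unit.
- by move=> i j; rewrite !gE sM.
- by move=> i j eij; rewrite gE zM.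
- by rewrite -(g_unit s).
- by move=> i j; have := sM (s^-1 i)%g (s^-1 j)%g; rewrite !gE !permKV.
- move=> i j eij; have := zM (s^-1 i)%g (s^-1 j)%g.
  by rewrite gE /= !permKV; apply.
Qed.

(** * Matrices whose row [w] vanishes off column [v] *)

Section Pendant.
Variables (K : finFieldType) (n : nat).

(** Index 0 plays the role of [v] and index 1 that of [w]; [C] is what remains when both are
    deleted. *)
Definition pendant_mx (a s : K) (x : 'rV[K]_n) (C : 'M[K]_n) : 'M[K]_(1 + (1 + n)) :=
  block_mx a%:M (row_mx s%:M x) (col_mx s%:M x^T) (block_mx 0 0 0 C).

(* Swapping the first two columns makes the matrix block triangular. *)
Lemma pendant_mx_unit a s x C :
  (pendant_mx a s x C \in unitmx) = (s != 0) && (C \in unitmx).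
Proof.
pose i0 : 'I_(1 + (1 + n)) := lshift _ 0.
pose i1 : 'I_(1 + (1 + n)) := rshift 1 (lshift n 0).
have -> : (pendant_mx a s x C \in unitmx) =
    (xcol i0 i1 (pendant_mx a s x C) \in unitmx).
  by rewrite xcolE unitmx_mul unitmx_perm andbT.
have -> : xcol i0 i1 (pendant_mx a s x C) =
    block_mx s%:M (row_mx a%:M x) 0 (block_mx s%:M 0 x^T C).
  apply/matrixP => i j; rewrite mxE.
  have [j' ->|j' ->] := split_ordP j.
    rewrite !ord1 tpermL /pendant_mx.
    have [i' ->|i' ->] := split_ordP i.
      by rewrite block_mxEur block_mxEul row_mxEl.
    rewrite block_mxEdr block_mxEdl.
    have [k ->|k ->] := split_ordP i'.
      by rewrite block_mxEul !mxE.
    by rewrite block_mxEdl !mxE.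
  have [k ->|k ->] := split_ordP j'.
    rewrite !ord1 tpermR /pendant_mx.
    have [i' ->|i' ->] := split_ordP i.
      by rewrite block_mxEur block_mxEul row_mxEl.
    rewrite block_mxEdl block_mxEdr.
    have [l ->|l ->] := split_ordP i'.
      by rewrite col_mxEu block_mxEul.
    by rewrite col_mxEd block_mxEdl.
  rewrite tpermD; try by apply/eqP => /(congr1 val).
  rewrite /pendant_mx.
  have [i' ->|i' ->] := split_ordP i.
    by rewrite !block_mxEur !row_mxEr.
  rewrite !block_mxEdr.
  have [l ->|l ->] := split_ordP i'.
    by rewrite !block_mxEur.
  by rewrite !block_mxEdr.
rewrite !unitmxE det_ublock det_lblock !det_scalar !expr1 !unitrM.
by rewrite unitfE andbA andbb.
Qed.

Lemma pendant_mx_inj a s x C a' s' x' C' :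
  pendant_mx a s x C = pendant_mx a' s' x' C' ->
  [/\ a = a', s = s', x = x' & C = C'].
Proof.
move=> /eq_block_mx[/matrixP/(_ 0 0) + /eq_row_mx[/matrixP/(_ 0 0) + ->] _].
move=> + + /eq_block_mx[_ _ _ ->].
by rewrite !mxE !mulr1n => -> ->.
Qed.

Lemma pendant_mx_surj (M : 'M[K]_(1 + (1 + n))) :
    (forall i j, M i j = M j i) ->
    (forall k : 'I_(1 + n), M (rshift 1 (lshift n 0)) (rshift 1 k) = 0) ->
  exists a s x C, M = pendant_mx a s x C.
Proof.
move=> sM zM.
exists (M (lshift _ 0) (lshift _ 0)), (M (lshift _ 0) (rshift 1 (lshift _ 0))).
exists (\row_j M (lshift _ 0) (rshift 1 (rshift 1 j))).
exists (\matrix_(i, j) M (rshift 1 (rshift 1 i)) (rshift 1 (rshift 1 j))).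
apply/matrixP => i j; rewrite /pendant_mx.
have [i' ->|i' ->] := split_ordP i; have [j' ->|j' ->] := split_ordP j.
- by rewrite block_mxEul !ord1 mxE.
- rewrite block_mxEur; have [k ->|k ->] := split_ordP j'.
    by rewrite row_mxEl !ord1 mxE.
  by rewrite row_mxEr !ord1 mxE.
- rewrite block_mxEdl; have [k ->|k ->] := split_ordP i'.
    by rewrite col_mxEu !ord1 mxE sM.
  by rewrite col_mxEd !ord1 !mxE sM.
rewrite block_mxEdr.
have [k ->|k ->] := split_ordP i'; have [l ->|l ->] := split_ordP j'.
- by rewrite block_mxEul ord1 zM mxE.
- by rewrite block_mxEur ord1 zM mxE.
- by rewrite block_mxEdl sM ord1 zM mxE.
- by rewrite block_mxEdr mxE.
Qed.

Lemma tr_pendant_mx a s x C : (pendant_mx a s x C)^T = pendant_mx a s x C^T.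
Proof.
by rewrite /pendant_mx !tr_block_mx tr_row_mx tr_col_mx trmxK !tr_scalar_mx !trmx0.
Qed.

Let i0 : 'I_(1 + (1 + n)) := lshift _ 0.
Let i1 : 'I_(1 + (1 + n)) := rshift 1 (lshift n 0).
Let up (k : 'I_n) : 'I_(1 + (1 + n)) := rshift 1 (rshift 1 k).

(** Row and column 0 are unconstrained, and row and column 1 are zero apart from [s], so only the
    constraints on [C] remain. *)
Lemma pendant_mx_Z_points (e : rel 'I_(1 + (1 + n))) a s x C :
    (forall j, e i0 j = false) -> (forall j, e j i0 = false) ->
  Z_points e (pendant_mx a s x C) = (s != 0) && Z_points (relpre up e) C.
Proof.
move=> e0 e0'; rewrite /Z_points pendant_mx_unit tr_pendant_mx -andbA.
congr [&& _, _ & _].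
have -> : (pendant_mx a s x C^T == pendant_mx a s x C) = (C^T == C).
  by apply/eqP/eqP => [/pendant_mx_inj[]|->].
congr andb; apply/'forall_forallP/'forall_forallP => zM i j; apply/implyP.
  by move=> /(implyP (zM (up i) (up j))); rewrite /pendant_mx !block_mxEdr.
have [i' ->|i' ->] := split_ordP i; first by rewrite ord1 e0.
have [j' ->|j' ->] := split_ordP j; first by rewrite ord1 e0'.
rewrite /pendant_mx block_mxEdr.
have [k ->|k ->] := split_ordP i'; have [l ->|l ->] := split_ordP j'.
- by rewrite block_mxEul mxE.
- by rewrite block_mxEur mxE.
- by rewrite block_mxEdl mxE.
- by rewrite block_mxEdr => ekl; apply: (implyP (zM k l)).
Qed.

(** The factor counts the choices of [a] (any), [s] (nonzero) and [x] (any). *)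
Lemma card_pendant_Z_points (e : rel 'I_(1 + (1 + n))) :
    (forall j, e i0 j = false) -> (forall j, e j i0 = false) ->
  #|[set M : 'M[K]_(1 + (1 + n)) | Z_points e M
       & [forall k, (k != i0) ==> (M i1 k == 0)]]|
    = ((#|K|.-1 * #|K| ^ n.+1) * Z_count (relpre up e) K)%N.
Proof.
move=> e0 e0'.
pose g (p : (K * K) * ('rV[K]_n * 'M[K]_n)) :=
  pendant_mx p.1.1 p.1.2 p.2.1 p.2.2.
pose D := setX (setX [set: K] [set~ (0 : K)])
  (setX [set: 'rV[K]_n] [set C : 'M[K]_n | Z_points (relpre up e) C]).
have g_inj : injective g.
  by move=> [[a s] [x C]] [[a' s'] [x' C']] /pendant_mx_inj /= [-> -> -> ->].
transitivity #|g @: D|.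
  apply: eq_card => M; apply/idP/imsetP => [|[[[a s] [x C]] + ->]].
    rewrite inE => /andP[ZM /forallP M1].
    have [||a [s [x [C defM]]]] := @pendant_mx_surj M.
    - by case/Z_pointsP: ZM.
    - by move=> k; apply/eqP/(implyP (M1 _)).
    exists ((a, s), (x, C)) => //.
    by move: ZM; rewrite defM pendant_mx_Z_points // !inE /= => ->.
  rewrite !inE /= => ZC; rewrite /g /= pendant_mx_Z_points // ZC /=.
  apply/forallP => k; apply/implyP.
  have [j ->|j ->] := split_ordP k; first by rewrite ord1 eqxx.
  rewrite /pendant_mx block_mxEdr.
  by have [l ->|l ->] := split_ordP j; rewrite ?block_mxEul ?block_mxEur mxE.
rewrite card_imset // !cardsX !cardsT cardsC1 card_mx mul1n /Z_count.
by rewrite expnS; rewrite !mulnA (mulnC #|K|).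
Qed.

End Pendant.

(** * Equidistribution of the entry [M v w] by shearing *)

Section Equidistribution.
Variables (K : finFieldType) (n : nat) (v w : 'I_n).
Hypothesis wv : w != v.
Implicit Types M : 'M[K]_n.

(* An index other than [v] at which row [w] is nonzero (when there is one); the
   choice ignores row and column [v], so [shear] does not change it. *)
Definition pivot (M : 'M[K]_n) : 'I_n :=
  odflt v [pick k | (k != v) && (M w k != 0)].

Definition shear_mx (c : K) (k : 'I_n) : 'M[K]_n := 1%:M + c *: delta_mx v k.

(* Adds a multiple of row [k] to row [v], and likewise for columns, so that
   entry [(v, w)] increases by [t]. *)
Definition shear (t : K) (M : 'M[K]_n) : 'M[K]_n :=
  let k := pivot M in
  let P := shear_mx (t / M w k) k in P *m M *m P^T.

Lemma shear_mxD c d k : k != v -> shear_mx c k *m shear_mx d k = shear_mx (c + d) k.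
Proof.
move=> kv; rewrite /shear_mx mulmxDl mul1mx mulmxDr mulmx1 -scalemxAl -scalemxAr.
by rewrite mul_delta_mx_0 // !scaler0 addr0 (addrC c) scalerDl addrA.
Qed.

Lemma shear_mx0 k : shear_mx 0 k = 1%:M.
Proof. by rewrite /shear_mx scale0r addr0. Qed.

Lemma shear_mx_unit c k : k != v -> shear_mx c k \in unitmx.
Proof.
move=> kv; suff /mulmx1_unit[] : shear_mx c k *m shear_mx (- c) k = 1%:M by [].
by rewrite shear_mxD // subrr shear_mx0.
Qed.

Lemma mul_shear_mxE c k M i j :
  (shear_mx c k *m M) i j = M i j + (i == v)%:R * c * M k j.
Proof.
rewrite /shear_mx mulmxDl mul1mx -scalemxAl !mxE (bigD1 k) //= mxE eqxx andbT.
rewrite big1 => [|l lk]; last by rewrite mxE (negPf lk) andbF mul0r.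
by rewrite addr0 mulrCA !mulrA.
Qed.

Lemma mul_tr_shear_mxE c k M i j :
  (M *m (shear_mx c k)^T) i j = M i j + (j == v)%:R * c * M i k.
Proof. by rewrite -[M]trmxK -trmx_mul mxE mul_shear_mxE !mxE. Qed.

Lemma shearE_out t M i j : i != v -> j != v -> shear t M i j = M i j.
Proof.
move=> iv jv; rewrite /shear mul_tr_shear_mxE mul_shear_mxE.
by rewrite (negPf iv) (negPf jv) !mul0r !addr0.
Qed.

Definition has_pivot (M : 'M[K]_n) := [exists k, (k != v) && (M w k != 0)].

Lemma pivotP M : has_pivot M -> pivot M != v /\ M w (pivot M) != 0.
Proof.
rewrite /pivot /has_pivot; case: pickP => [k /andP[] //|none /existsP[k]].
by rewrite none.
Qed.

Lemma shearE t M : (forall i j, M i j = M j i) -> has_pivot M ->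
  shear t M v w = M v w + t.
Proof.
move=> sM /pivotP[kv Mk].
rewrite /shear mul_tr_shear_mxE mul_shear_mxE eqxx (negPf wv) !mul0r addr0 mul1r.
by rewrite [M (pivot M) w]sM divfK.
Qed.

Lemma pivot_shear t M : pivot (shear t M) = pivot M.
Proof.
rewrite /pivot; congr (odflt _ _); apply: eq_pick => k.
by have [//|kv] := eqVneq k v; rewrite shearE_out.
Qed.

Lemma has_pivot_shear t M : has_pivot (shear t M) = has_pivot M.
Proof.
by apply: eq_existsb => k; have [//|kv] := eqVneq k v; rewrite shearE_out.
Qed.

Lemma shear_sym t M : (forall i j, M i j = M j i) ->
  forall i j, shear t M i j = shear t M j i.
Proof.
move=> sM i j.
have MT : M^T = M by apply/matrixP => k l; rewrite mxE.
by rewrite -[in LHS](trmxK (shear t M)) mxE /shear !trmx_mul trmxK MT mulmxA.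
Qed.

(** Both shears have the same pivot [k] and the same divisor [M w k], which lies outside row and
    column [v]; hence the coefficients add up. *)
Lemma shearD t u M : has_pivot M -> shear t (shear u M) = shear (t + u) M.
Proof.
move=> hM; have [kv _] := pivotP hM.
rewrite {1}/shear pivot_shear shearE_out // /shear.
by rewrite !mulmxA shear_mxD // -!mulmxA -trmx_mul shear_mxD // mulrDl addrC.
Qed.

Lemma shear0 M : shear 0 M = M.
Proof. by rewrite /shear mul0r shear_mx0 trmx1 mulmx1 mul1mx. Qed.

Lemma shear_unit t M : has_pivot M -> (shear t M \in unitmx) = (M \in unitmx).
Proof.
move=> /pivotP[kv _].
by rewrite /shear !unitmx_mul unitmx_tr shear_mx_unit // andbT.
Qed.

Lemma shear_Z_points (e : rel 'I_n) t M :
    (forall j, e v j = false) -> (forall j, e j v = false) ->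
  has_pivot M -> Z_points e M -> Z_points e (shear t M).
Proof.
move=> ev ev' hM /Z_pointsP[uM sM zM]; apply/Z_pointsP; split.
- by rewrite shear_unit.
- exact: shear_sym.
- move=> i j eij; rewrite shearE_out ?zM //.
  + by apply: contraTneq eij => ->; rewrite ev.
  + by apply: contraTneq eij => ->; rewrite ev'.
Qed.

(** By [shearD] and [shear0] the additive group of [K] acts on the matrices with a pivot,
    translating [M v w]. Each orbit thus meets the slice [M v w = 0] exactly once, and
    [(t, M) |-> shear t M] is a bijection from [K] times the slice. *)
Lemma card_has_pivot_Z_points (e : rel 'I_n) :
    (forall j, e v j = false) -> (forall j, e j v = false) ->
  #|[set M : 'M[K]_n | Z_points e M & has_pivot M]| =
  (#|K| * #|[set M : 'M[K]_n | [&& Z_points e M, has_pivot M & M v w == 0%R]]|)%N.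
Proof.
move=> ev ev'; pose A := [set M | [&& Z_points e M, has_pivot M & M v w == 0%R]].
pose g (p : K * 'M[K]_n) := shear p.1 p.2.
have gP t M : M \in A -> g (t, M) v w = t /\ shear (- t) (g (t, M)) = M.
  rewrite !inE => /and3P[/Z_pointsP[_ sM _] hM /eqP M0].
  by rewrite /g /= shearE // M0 add0r shearD // addNr shear0.
rewrite -cardsT -cardsX -/A -(card_in_imset (f := g)) => [|[t M] [u N]].
  apply: eq_card => M; apply/idP/imsetP => [|[[t N]]].
    rewrite inE => /andP[ZM hM]; exists (M v w, shear (- M v w) M).
      rewrite !inE /= shear_Z_points // has_pivot_shear hM shearE ?subrr //=.
      by case/Z_pointsP: ZM.
    by rewrite /g /= shearD // subrr shear0.
  rewrite !inE /= => /and3P[ZN hN _] ->.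
  by rewrite /g has_pivot_shear hN andbT shear_Z_points.
rewrite !in_setX => /andP[_ MA] /andP[_ NA] gE.
have [[tE ME] [uE NE]] := (gP t M MA, gP u N NA).
have tu : t = u by rewrite -tE -uE gE.
by rewrite -ME -NE tu -gE tu.
Qed.

End Equidistribution.

(** * The recursion that adds an edge *)

Section AddEdge.
Variable n : nat.

Let i0 : 'I_(1 + (1 + n)) := lshift _ 0.
Let i1 : 'I_(1 + (1 + n)) := rshift 1 (lshift n 0).
Let up (k : 'I_n) : 'I_(1 + (1 + n)) := rshift 1 (rshift 1 k).

Lemma Z_count_add_edge01 (e : rel 'I_(1 + (1 + n))) (K : finFieldType) :
    (forall j, e i0 j = false) -> (forall j, e j i0 = false) ->
  Z_count e K = (#|K| * Z_count (add_edge i0 i1 e) K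
    + (#|K|.-1 * #|K| ^ n.+1) * Z_count (relpre up e) K)%N.
Proof.
move=> e0 e0'; rewrite -card_pendant_Z_points //.
pose pv := [set M : 'M[K]_(1 + (1 + n)) | has_pivot i0 i1 M].
rewrite {1}/Z_count -(cardsID pv); congr (_ + _)%N; last first.
  apply: eq_card => M; rewrite !inE andbC; congr andb.
  by rewrite negb_exists; apply: eq_forallb => k; rewrite implybE negb_and !negbK.
transitivity #|[set M : 'M[K]_(1 + (1 + n)) | Z_points e M & has_pivot i0 i1 M]|.
  by apply: eq_card => M; rewrite !inE.
rewrite card_has_pivot_Z_points //; congr (_ * _)%N.
apply: eq_card => M; rewrite !inE; apply/and3P/idP => [[ZM _ /eqP M0]|].
  case/Z_pointsP: ZM => uM sM zM; apply/Z_pointsP; split=> // i j.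
  by case/or3P=> [|/andP[/eqP-> /eqP->]|/andP[/eqP-> /eqP->]];
    [exact: zM | exact: M0 | rewrite sM].
case/Z_pointsP => uM sM zM; split.
- by apply/Z_pointsP; split=> // i j eij; apply: zM; rewrite /add_edge eij.
(* With the edge added, a pivot exists automatically: otherwise the whole row [i1] would vanish. *)
- apply: contraLR uM; rewrite negb_exists => /forallP M1.
  have M1k k : M i1 k = 0.
    have [->|k0] := eqVneq k i0.
      by apply: zM; rewrite /add_edge !eqxx !orbT.
    by apply/eqP; have := M1 k; rewrite k0 negbK.
  by rewrite unitmxE (expand_det_row _ i1) big1 ?unitr0 // => k _; rewrite M1k mul0r.
- by apply/eqP/zM; rewrite /add_edge !eqxx orbT.
Qed.

(** The map [h] enumerates the vertices other than [v] and [w]. It is chosen before [K], so that one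
    polynomial for [relpre h e] serves all fields. *)
Lemma Z_count_add_edge (e : rel 'I_n.+2) (v w : 'I_n.+2) :
    v != w -> (forall j, e v j = false) -> (forall j, e j v = false) ->
  exists h : 'I_n -> 'I_n.+2,
    [/\ injective h, forall k, h k != v, forall k, h k != w
      & forall K : finFieldType,
        Z_count e K = (#|K| * Z_count (add_edge v w e) K
          + (#|K|.-1 * #|K| ^ n.+1) * Z_count (relpre h e) K)%N].
Proof.
move=> vw ev ev'.
have i01 : i1 != i0 by [].
have [s s0 s1] : exists2 s : 'S_n.+2, s i0 = v & s i1 = w.
  have tv : tperm i0 v i1 != v.
    by rewrite -[X in _ != X](tpermL i0 v) (inj_eq perm_inj).
  (* The first transposition sends [i0] to [v]; the second corrects the image of [i1] and fixes
     [v]. *)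
  exists (tperm i0 v * tperm (tperm i0 v i1) w)%g; rewrite permM.
    by rewrite tpermL (tpermD tv) // eq_sym.
  by rewrite tpermL.
exists (s \o up); split=> [|k|k|K].
- by move=> k l /perm_inj/(congr1 val)/= [] /val_inj.
- by rewrite /= -s0 (inj_eq perm_inj).
- by rewrite /= -s1 (inj_eq perm_inj).
rewrite -(Z_count_relpre_perm e s).
rewrite Z_count_add_edge01 => [|j|j]; rewrite /= ?s0 //.
rewrite -(Z_count_relpre_perm (add_edge v w e) s).
congr (_ * _ + _)%N; apply: eq_Z_count => i j.
by rewrite /add_edge /= -s0 -s1 !(inj_eq perm_inj).
Qed.

End AddEdge.

(** * Subgraphs and leaves of forests *)

Lemma forest_homo (T T' : finType) (h : T' -> T) (e : rel T) (e' : rel T') :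
    injective h -> {homo h : i j / e' i j >-> e i j} -> symmetric e' ->
  forest e -> forest e'.
Proof.
move=> h_inj he e'_sym [[_ e_irr] acyc]; split; first split=> //.
  by move=> i; apply: contraFF (e_irr (h i)) => /he.
move=> c [c2 /andP[e'c uc]]; apply: (acyc (map h c)).
by rewrite /graph_cycle size_map /ucycle map_inj_uniq // uc (homo_cycle he).
Qed.

Lemma forest_leaf (T : finType) (e : rel T) (x0 y0 : T) :
    forest e -> e x0 y0 ->
  exists v w, e v w /\ forall u, e v u -> u = w.
Proof.
move=> [[e_sym e_irr] acyc] e0.
have [/existsP[v /existsP[w /andP[vw /forallP leaf]]]|noleaf] :=
  boolP [exists v, exists w, e v w && [forall u, e v u ==> (u == w)]].
  by exists v, w; split=> // u vu; apply/eqP/(implyP (leaf u)).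
have extend v w : e v w -> exists2 u, e v u & u != w.
  move=> vw; move: noleaf; rewrite negb_exists => /forallP/(_ v).
  rewrite negb_exists => /forallP/(_ w); rewrite vw negb_forall => /existsP[u].
  by rewrite negb_imply => /andP[]; exists u.
(* Without leaves, every path can be prolonged at its start. *)
have long k : exists x y p, [/\ size p = k, path e x (y :: p) & uniq [:: x, y & p]].
  elim: k => [|k [x [y [p [sz exp ux]]]]].
    exists x0, y0, [::]; rewrite /= e0 andbT inE; split=> //.
    by rewrite andbT; apply: contraTneq e0 => ->; rewrite e_irr.
  have [/= exy _] := andP exp; have [u xu uy] := extend _ _ exy.
  exists u, x, (y :: p); rewrite [path _ _ _]/= e_sym xu; split=> //.
    by rewrite /= sz.
  rewrite [uniq _]/= -/(uniq [:: x, y & p]) ux andbT !inE (negPf uy) /= negb_or.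
  apply/andP; split; first by apply: contraTneq xu => ->; rewrite e_irr.
  (* If [u] were already on the path, the segment from [x] to [u] would close up to a cycle. *)
  apply/negP => up; case/splitPr: up sz exp ux => p1 p2 sz exp ux.
  apply: (acyc [:: x, y & rcons p1 u]); split; first by rewrite /= size_rcons.
  move: exp ux; rewrite -cat_rcons -!cat_cons cat_path cat_uniq.
  move=> /andP[exp _] /andP[ux _]; rewrite /ucycle ux andbT.
  by rewrite (cycle_path x) /= last_rcons e_sym xu.
(* A path with [#|T| + 2] distinct vertices cannot exist. *)
have [x [y [p [sz _ /card_uniqP/= sz']]]] := long #|T|.
by have := max_card (mem [:: x, y & p]); rewrite sz' sz => /ltnW; rewrite ltnn.
Qed.

(** * Polynomial counts and the recursion read in both directions *)

Definition polynomial_count (n : nat) (e : rel 'I_n) : Prop :=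
  exists f : {poly int}, forall K : finFieldType,
    (Z_count e K)%:Z = f.[#|K|%:Z].

Lemma eq_polynomial_count (n : nat) (e e' : rel 'I_n) :
  e =2 e' -> polynomial_count e -> polynomial_count e'.
Proof. by move=> ee' [f fE]; exists f => K; rewrite -(eq_Z_count K ee'). Qed.

(* The constant term of [f] is divisible by every prime, hence is zero. *)
Lemma polynomial_div_card (f : {poly int}) (c : finFieldType -> nat) :
    (forall K : finFieldType, f.[#|K|%:Z] = #|K|%:Z * (c K)%:Z) ->
  exists g : {poly int}, forall K : finFieldType, (c K)%:Z = g.[#|K|%:Z].
Proof.
move=> fE; have /factor_theorem[g gE] : root (f - f.[0]%:P) 0.
  by rewrite rootE !hornerE subrr.
have {}gE x : f.[x] = g.[x] * x + f.[0].
  by have := congr1 (horner^~ x) gE; rewrite !hornerE => <-; rewrite subrK.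
have f0 : f.[0] = 0.
  have [p ltp p_pr] := prime_above `|f.[0]|%N.
  have := fE 'F_p; rewrite card_Fp // gE => /(canRL (addKr _)).
  rewrite [_ * p%:Z]mulrC -mulrN -mulrDr => f0E.
  apply/eqP; rewrite -absz_eq0; move: ltp; rewrite f0E abszM /=.
  by case: (absz (_ + _)) => [|m]; rewrite ?muln0 // mulnS ltnNge leq_addr.
exists g => K; have K0 : #|K|%:Z != 0 by rewrite -lt0n (cardD1 0).
by apply: (mulfI K0); rewrite -fE gE f0 addr0 mulrC.
Qed.

Lemma predn_card_finField (K : finFieldType) : (#|K|.-1)%:Z = #|K|%:Z - 1.
Proof.
have K0 : (0 < #|K|)%N by rewrite (cardD1 0).
by rewrite -[in RHS](prednK K0) intS addrAC subrr add0r.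
Qed.

Lemma PoszX (m k : nat) : (m ^ k)%N%:Z = m%:Z ^+ k.
Proof. by rewrite -!natz natrX. Qed.

Section AddEdgePolynomial.
Variables (n : nat) (e : rel 'I_n.+2) (v w : 'I_n.+2).
Hypotheses (vw : v != w).
Hypotheses (ev : forall j, e v j = false) (ev' : forall j, e j v = false).
Hypothesis del : forall h : 'I_n -> 'I_n.+2, injective h ->
  (forall k, h k != v) -> (forall k, h k != w) -> polynomial_count (relpre h e).

Lemma polynomial_count_of_add_edge :
  polynomial_count (add_edge v w e) -> polynomial_count e.
Proof.
move=> [f fE]; have [h [h_inj hv hw ZE]] := Z_count_add_edge vw ev ev'.
have [g gE] := del h_inj hv hw.
exists ('X * f + ('X - 1) * 'X^(n.+1) * g) => K.
rewrite ZE PoszD !PoszM PoszX predn_card_finField fE gE.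
by rewrite !(hornerE, hornerXn).
Qed.

(** The recursion only gives [q] times the desired count as a polynomial in [q];
    [polynomial_div_card] removes the factor. *)
Lemma polynomial_count_add_edge :
  polynomial_count e -> polynomial_count (add_edge v w e).
Proof.
move=> [f fE]; have [h [h_inj hv hw ZE]] := Z_count_add_edge vw ev ev'.
have [g gE] := del h_inj hv hw.
apply: (@polynomial_div_card (f - ('X - 1) * 'X^(n.+1) * g)) => K.
rewrite !(hornerE, hornerXn) -fE -gE ZE PoszD !PoszM PoszX predn_card_finField.
by rewrite addrK.
Qed.

End AddEdgePolynomial.

(** * Stars with a loop at the centre *)

Definition edgeless (n : nat) : rel 'I_n := fun _ _ => false.

(* [w] is meant to lie in [A], and thus carries a loop. *)
Definition loop_star (n : nat) (w : 'I_n) (A : {set 'I_n}) : rel 'I_n :=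
  fun i j => ((i == w) && (j \in A)) || ((j == w) && (i \in A)).

(** Induction on the complement of [A]. A vertex [v] outside [A] is unconstrained; joining it to [w]
    enlarges [A] by [v], while deleting [v] and [w] leaves an edgeless graph. *)
Lemma polynomial_count_loop_star (n : nat) (w : 'I_n.+2) (A : {set 'I_n.+2}) :
  polynomial_count (@edgeless n) -> w \in A -> polynomial_count (loop_star w A).
Proof.
move=> pn; have [k] := ubnP #|~: A|; elim: k A => // k IHk A ltAk wA.
have [/existsP[v vA]|] := boolP [exists v, v \notin A]; last first.
  (* Here [A] contains every vertex, so row [w] is zero and no matrix is invertible. *)
  rewrite negb_exists => /forallP AT; exists 0 => K; rewrite horner0.
  apply/eqP; rewrite eqz_nat cards_eq0 -subset0; apply/subsetP => M.
  rewrite inE => /Z_pointsP[uM _ zM]; move: uM.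
  rewrite unitmxE (expand_det_row _ w) big1 ?unitr0 // => j _.
  by rewrite zM ?mul0r // /loop_star eqxx /=; have := AT j; rewrite negbK => ->.
have vw : v != w by apply: contraNneq vA => ->.
apply: (@polynomial_count_of_add_edge _ _ v w) => // [j|j|h _ _ hw|].
- by rewrite /loop_star (negPf vw) (negPf vA) andbF.
- by rewrite /loop_star (negPf vw) (negPf vA) andbF.
- by apply: eq_polynomial_count pn => i j; rewrite /loop_star /= !(negPf (hw _)).
- apply: (@eq_polynomial_count _ (loop_star w (v |: A))).
    move=> i j; rewrite /loop_star /add_edge !inE.
    by case: (i == w); case: (j == w); case: (i == v); case: (j == v);
      case: (i \in A); case: (j \in A).
  apply: IHk; last by rewrite inE wA orbT.
  rewrite -ltnS; apply: leq_trans ltAk; rewrite ltnS; apply: proper_card.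
  rewrite properC properEneq subsetUr andbT.
  by apply: contraNneq vA => ->; rewrite setU11.
Qed.

(** * The edgeless graph by Schur complements *)

Section Schur.
Variables (K : finFieldType) (n : nat).

(** The parameter [C] is the Schur complement of [a], not the lower right block; for [a != 0],
    invertibility then depends on [C] alone. *)
Definition bordered_mx (a : K) (x : 'rV[K]_n) (C : 'M[K]_n) : 'M[K]_(1 + n) :=
  block_mx a%:M x x^T (C + a^-1 *: (x^T *m x)).

Lemma bordered_mx_unit a x C :
  a != 0 -> (bordered_mx a x C \in unitmx) = (C \in unitmx).
Proof.
move=> a0; have -> : bordered_mx a x C =
    block_mx 1%:M 0 (a^-1 *: x^T) 1%:M *m block_mx a%:M x 0 C.
  rewrite mulmx_block !mul1mx !mul0mx !addr0 -scalemxAl mul_mx_scalar scalerA.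
  by rewrite mulVf // scale1r -scalemxAl; congr block_mx; rewrite addrC.
rewrite unitmxE det_mulmx det_lblock det_ublock !det_scalar !expr1n !mul1r expr1.
by rewrite unitrM unitfE a0 unitmxE.
Qed.

Lemma bordered_mx_inj a x C a' x' C' :
  bordered_mx a x C = bordered_mx a' x' C' -> [/\ a = a', x = x' & C = C'].
Proof.
move=> /eq_block_mx[/matrixP/(_ 0 0)]; rewrite !mxE !mulr1n => -> -> _.
by move=> /addIr ->.
Qed.

Lemma tr_bordered_mx a x C : (bordered_mx a x C)^T = bordered_mx a x C^T.
Proof.
rewrite /bordered_mx tr_block_mx trmxK tr_scalar_mx !linearD !linearZ /=.
by rewrite trmx_mul trmxK.
Qed.

Lemma Z_points_edgeless m (M : 'M[K]_m) :
  Z_points (@edgeless m) M = (M \in unitmx) && (M^T == M).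
Proof.
by rewrite /Z_points; congr andb; rewrite andb_idr // => _; apply/'forall_forallP.
Qed.

Lemma card_edgeless_diag_neq0 :
  #|[set M : 'M[K]_(1 + n) | Z_points (@edgeless (1 + n)) M
       & M (lshift n 0) (lshift n 0) != 0%R]|
  = (#|K|.-1 * #|K| ^ n * Z_count (@edgeless n) K)%N.
Proof.
pose g (p : K * ('rV[K]_n * 'M[K]_n)) := bordered_mx p.1 p.2.1 p.2.2.
pose D := setX [set~ (0 : K)]
  (setX [set: 'rV[K]_n] [set C : 'M[K]_n | Z_points (@edgeless n) C]).
have g_inj : injective g.
  by move=> [a [x C]] [a' [x' C']] /bordered_mx_inj /= [-> -> ->].
have ZgE a x C : a != 0 -> Z_points (@edgeless (1 + n)) (bordered_mx a x C) =
    Z_points (@edgeless n) C.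
  move=> a0; rewrite !Z_points_edgeless bordered_mx_unit // tr_bordered_mx.
  by congr andb; apply/eqP/eqP => [/bordered_mx_inj[]|->].
transitivity #|g @: D|.
  apply: eq_card => M; apply/idP/imsetP => [|[[a [x C]] + ->]].
    rewrite inE => /andP[ZM M0].
    pose a := M (lshift n 0) (lshift n 0); pose x := ursubmx M.
    pose C := drsubmx M - a^-1 *: (x^T *m x).
    have defM : M = bordered_mx a x C.
      case/Z_pointsP: ZM => _ sM _.
      rewrite -[LHS](submxK (M : 'M_(1 + n))) /bordered_mx subrK; congr block_mx.
        by apply/matrixP => i j; rewrite !ord1 !mxE.
      by apply/matrixP => i j; rewrite !ord1 !mxE sM.
    by exists (a, (x, C)) => //; rewrite !inE /= M0 -(ZgE a x) // -defM.
  rewrite !inE /= => /andP[a0 ZC]; rewrite /g /= ZgE // ZC /bordered_mx.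
  by rewrite block_mxEul mxE.
by rewrite card_imset // !cardsX !cardsT cardsC1 card_mx mul1n mulnA.
Qed.

(** The matrices with zero corner entry are those of the graph whose only edge is a loop at
    [ord0]. *)
Lemma Z_count_edgelessS :
  Z_count (@edgeless n.+1) K = (#|K|.-1 * #|K| ^ n * Z_count (@edgeless n) K
    + Z_count (@loop_star n.+1 ord0 [set ord0]) K)%N.
Proof.
rewrite -card_edgeless_diag_neq0 {1}/Z_count.
rewrite -[LHS](cardsID [set M : 'M[K]_(1 + n) | M (lshift n 0) (lshift n 0) != 0]).
have -> : lshift n 0 = ord0 :> 'I_(1 + n) by apply: val_inj.
congr (_ + _)%N; apply: eq_card => M; first by rewrite !inE.
rewrite !inE negbK andbC; apply/andP/Z_pointsP => [[ZM /eqP M0]|[uM sM zM]].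
  case/Z_pointsP: ZM => uM sM _; split=> // i j; rewrite /loop_star !inE.
  by rewrite andbC orbb => /andP[/eqP-> /eqP->].
split; first by apply/Z_pointsP.
by rewrite zM // /loop_star inE eqxx.
Qed.

End Schur.

Lemma polynomial_count_edgeless n : polynomial_count (@edgeless n).
Proof.
have polyS m : polynomial_count (@edgeless m) ->
    polynomial_count (@loop_star m.+1 ord0 [set ord0]) ->
    polynomial_count (@edgeless m.+1).
  move=> [f fE] [g gE]; exists (('X - 1) * 'X^m * f + g) => K.
  rewrite Z_count_edgelessS PoszD !PoszM PoszX predn_card_finField fE gE.
  by rewrite !(hornerE, hornerXn).
have [k] := ubnP n; elim: k n => // k IHk [|[|n]] ltnk.
(* The empty matrix is invertible, so the count is 1. *)
- exists 1 => K; rewrite hornerC -[RHS]/(1%:Z); congr Posz.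
  rewrite /Z_count (_ : [set M | _] = [set 1%:M]) ?cards1 //.
  apply/setP => M; rewrite !inE Z_points_edgeless [M]flatmx0 [1%:M]flatmx0 trmx0.
  by rewrite unitmxE det_mx00 unitr1 !eqxx.
- apply: polyS; first exact: IHk.
  (* On one vertex, [polynomial_count_loop_star] does not apply; the loop forces the only entry to
     be zero. *)
  exists 0 => K; rewrite horner0; apply/eqP; rewrite eqz_nat cards_eq0 -subset0.
  apply/subsetP => M; rewrite inE => /Z_pointsP[+ _ zM].
  rewrite unitmxE det_mx11 zM ?unitr0 // /loop_star.
  by rewrite inE eqxx.
- apply: polyS; first exact: IHk.
  by apply: polynomial_count_loop_star; [apply: IHk; apply: ltnW | rewrite inE].
Qed.

(** * Induction over forests *)

Theorem corollary12p2 (n : nat) (e : rel 'I_n) (he : forest e) :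
  exists f : {poly int}, forall K : finFieldType,
    (Z_count e K)%:Z = f.[#|K|%:Z].
Proof.
rewrite -/(polynomial_count e).
(* The outer induction is on the number of vertices, the inner one on the number of ordered adjacent
   pairs. *)
have [k] := ubnP n; elim: k n e he => // k IHk n e he ltnk.
have [m] := ubnP #|[set p : 'I_n * 'I_n | e p.1 p.2]|.
elim: m e he => // m IHm e he ltem.
have [/existsP[x /existsP[y exy]]|/existsPn noedge] :=
  boolP [exists x, exists y, e x y]; last first.
  apply: eq_polynomial_count (polynomial_count_edgeless n) => i j.
  by have /existsPn/(_ j)/negPf -> := noedge i.
have [v [w [evw leaf]]] := forest_leaf he exy.
have [e_sym e_irr] := he.1.
have vw : v != w by apply: contraTneq evw => ->; rewrite e_irr.
case: n => [|[|n]] in e he ltnk m IHm ltem x y exy v w evw leaf e_sym e_irr vw *.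
- by case: v vw evw leaf.
- by rewrite !ord1 in vw.
(* Isolate the leaf [v]: this removes only the edge [vw], so [e] is [add_edge v w e']. *)
pose e' : rel 'I_n.+2 := fun i j => [&& e i j, i != v & j != v].
have e'_sym : symmetric e' by move=> i j; rewrite /e' e_sym andbCA andbC andbA.
have he' : forest e'.
  by apply: (forest_homo (h := id)) he => // i j /andP[].
apply: (@eq_polynomial_count _ (add_edge v w e')).
  move=> i j; rewrite /add_edge /e'.
  have [->|iv] := eqVneq i v; have [->|jv] := eqVneq j v;
    rewrite ?andbF ?andbT ?orbF ?(negPf vw) //=.
  - by apply/eqP/idP => [->|/leaf].
  - by rewrite e_sym; apply/eqP/idP => [->|/leaf].
(* Subgraphs of [e'] without [v] and [w] have fewer vertices, and [e'] itself has fewer edges. *)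
apply: polynomial_count_add_edge => // [j|j|h h_inj _ _|].
- by rewrite /e' eqxx andbF.
- by rewrite /e' eqxx !andbF.
- apply: IHk; last exact: ltnW.
  by apply: (forest_homo h_inj) he' => // i j /=; rewrite e'_sym.
apply: IHm => //; rewrite -ltnS; apply: leq_trans ltem; rewrite ltnS.
apply: proper_card; apply/properP; split.
  by apply/subsetP => p; rewrite !inE => /andP[].
by exists (v, w); rewrite !inE //= /e' eqxx andbF.
Qed.
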